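(* Let $\mathcal{A}$ be a unital $*$-algebra over $\mathbb{C}$ and let $(M,h,\mathfrak{g}_\varphi)$ be a real metric calculus over $M$ (where $M$ is a right $\mathcal{A}$-module). Then there exists at most one affine connection $\nabla$ on $(M,\mathfrak{g})$ such that $(M,h,\mathfrak{g}_\varphi,\nabla)$ is a pseudo-Riemannian calculus.
   Context: $\mathcal{A}$ is a unital $*$-algebra over $\mathbb{C}$; $\mathrm{Der}(\mathcal{A})$ is the set of derivations of $\mathcal{A}$ into $\mathcal{A}$. A derivation $d$ is hermitian if $d=d^*$, where $d^*(a)=(d(a^* ))^*$. An element $a\in\mathcal{A}$ is hermitian if $a^*=a$. A hermitian form on a right $\mathcal{A}$-module $M$ is a map $h:M\times M\to\mathcal{A}$ with $h(U,V+W)=h(U,V)+h(U,W)$, $h(U,Va)=h(U,V)a$, $h(U,V)^*=h(V,U)$. It is non-degenerate if $h(U,V)=0$ for all $V\in M$ implies $U=0$. A non-degenerate hermitian form is called a metric, and $(M,h)$ is then a metric $\mathcal{A}$-module. Let $\mathfrak{g}\subseteq\mathrm{Der}(\mathcal{A})$ be a real Lie algebra of hermitian derivations. An affine connection on $(M,\mathfrak{g})$ is a map $\nabla:\mathfrak{g}\times M\to M$ with $\nabla_d(U+V)=\nabla_dU+\nabla_dV$, $\nabla_{\lambda d+d'}U=\lambda\nabla_dU+\nabla_{d'}U$, $\nabla_d(Ua)=(\nabla_dU)a+U d(a)$ for all $U,V\in M$, $d,d'\in\mathfrak{g}$, $a\in\mathcal{A}$, $\lambda\in\mathbb{R}$.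 Real metric calculus: $(M,h)$ is a metric $\mathcal{A}$-module, $\mathfrak{g}\subseteq\mathrm{Der}(\mathcal{A})$ is a real Lie algebra of hermitian derivations, $\varphi:\mathfrak{g}\to M$ is $\mathbb{R}$-linear, and $\mathfrak{g}_\varphi$ denotes the pair $(\mathfrak{g},\varphi)$. The triple $(M,h,\mathfrak{g}_\varphi)$ is a real metric calculus if (1) $M_\varphi=\varphi(\mathfrak{g})$ generates $M$ as an $\mathcal{A}$-module and (2) $h(E,E')^*=h(E,E')$ for all $E,E'\in M_\varphi$. Real connection calculus: a real metric calculus with an affine connection $\nabla$ on $(M,\mathfrak{g})$ such that $h(\nabla_dE,E')$ is hermitian for all $E,E'\in M_\varphi$, $d\in\mathfrak{g}$. A real connection calculus is metric if $d(h(U,V))=h(\nabla_dU,V)+h(U,\nabla_dV)$ for all $d\in\mathfrak{g}$, $U,V\in M$, and torsion-free if $\nabla_{d_1}\varphi(d_2)-\nabla_{d_2}\varphi(d_1)-\varphi([d_1,d_2])=0$ for all $d_1,d_2\in\mathfrak{g}$. A pseudo-Riemannian calculus is a metric and torsion-free real connection calculus. *)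

(* Defs.v *)
From HB Require Import structures.
From mathcomp Require Import all_boot all_order all_algebra.
From mathcomp Require Import boolp classical_sets functions reals.
From mathcomp Require Import complex.

Set Implicit Arguments.
Unset Strict Implicit.
Unset Printing Implicit Defensive.

Import GRing.Theory Num.Theory.

Local Open Scope ring_scope.
Local Open Scope complex_scope.
Local Open Scope classical_set_scope.

(* The complex numbers are R[i] with R : realType. *)
HB.mixin Record isStarAlgebra (R : realType) A of GRing.Algebra R[i] A := {
  star : A -> A;
  starK : forall a : A, star (star a) = a;
  starD : forall a b : A, star (a + b) = star a + star b;
  starZ : forall (c : R[i]) (a : A), star (c *: a) = Num.conj c *: star a;
  starM : forall a b : A, star (a * b) = star b * star a
}.

#[short(type="starAlgType")]
HB.structure Definition StarAlgebra (R : realType) :=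
  { A of GRing.Algebra R[i] A & isStarAlgebra R A }.

Section Algebra.
Variables (R : realType) (A : starAlgType R).

Definition hermitian (a : A) : Prop := star a = a.

Definition derivation (d : A -> A) : Prop :=
  (forall (c : R[i]) (a b : A), d (c *: a + b) = c *: d a + d b) /\
  (forall a b : A, d (a * b) = d a * b + a * d b).

Definition conj_map (d : A -> A) : A -> A := fun a => star (d (star a)).

Definition hermitian_map (d : A -> A) : Prop := d = conj_map d.

Definition commutator (d1 d2 : A -> A) : A -> A :=
  fun a => d1 (d2 a) - d2 (d1 a).

(* Sums and scalar multiples of maps A -> A are pointwise. *)
Record hermLieAlg := HermLieAlg {
  lie_carrier :> set (A -> A);
  lie_derivation : forall d, lie_carrier d -> derivation d;
  lie_hermitian : forall d, lie_carrier d -> hermitian_map d;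
  lie_zero : lie_carrier 0;
  lie_linear : forall (l : R) d d', lie_carrier d -> lie_carrier d' ->
    lie_carrier (l%:C *: d + d');
  lie_commutator : forall d d', lie_carrier d -> lie_carrier d' ->
    lie_carrier (commutator d d')
}.

Variable g : hermLieAlg.

Lemma lie_comb_subproof (l : R) (d d' : g) :
  l%:C *: val d + val d' \in (g : set _).
Proof. by apply/mem_set/lie_linear; apply: set_valP. Qed.

Definition lie_comb (l : R) (d d' : g) : g :=
  SigSub (lie_comb_subproof l d d').

Lemma lie_bracket_subproof (d d' : g) :
  commutator (val d) (val d') \in (g : set _).
Proof. by apply/mem_set/lie_commutator; apply: set_valP. Qed.

Definition lie_bracket (d d' : g) : g := SigSub (lie_bracket_subproof d d').

End Algebra.

Section Calculus.
Variables (R : realType) (A : starAlgType R).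

(* A right A-module is a left module over the converse ring A^c. *)
Variable M : lmodType A^c.

Definition ract (U : M) (a : A) : M := (a : A^c) *: U.

(* Scalars act on M through the unit of A. *)
Definition scaleM (l : R) (U : M) : M := ract U (l%:C *: 1).

Record hermitian_form (h : M -> M -> A) : Prop := HermitianForm {
  form_add : forall U V W, h U (V + W) = h U V + h U W;
  form_act : forall U V a, h U (ract V a) = h U V * a;
  form_star : forall U V, star (h U V) = h V U
}.

Definition nondegenerate (h : M -> M -> A) : Prop :=
  forall U, (forall V, h U V = 0) -> U = 0.

Definition metric (h : M -> M -> A) : Prop :=
  hermitian_form h /\ nondegenerate h.

Definition generates (S : set M) : Prop :=
  forall U : M, exists (n : nat) (E : 'I_n -> M) (a : 'I_n -> A),
    (forall i, S (E i)) /\ U = \sum_(i < n) ract (E i) (a i).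

Variable g : hermLieAlg A.

Record affine_connection (nabla : g -> M -> M) : Prop := AffineConnection {
  conn_addr : forall d U V, nabla d (U + V) = nabla d U + nabla d V;
  conn_linearl : forall (l : R) (d d' : g) U,
    nabla (lie_comb l d d') U = scaleM l (nabla d U) + nabla d' U;
  conn_leibniz : forall (d : g) U a,
    nabla d (ract U a) = ract (nabla d U) a + ract U (val d a)
}.

Definition real_linear (phi : g -> M) : Prop :=
  forall (l : R) (d d' : g), phi (lie_comb l d d') = scaleM l (phi d) + phi d'.

Record real_metric_calculus (h : M -> M -> A) (phi : g -> M) : Prop :=
  RealMetricCalculus {
    rmc_metric : metric h;
    rmc_linear : real_linear phi;
    rmc_generates : generates (range phi);
    rmc_hermitian : forall E E', range phi E -> range phi E' ->
      hermitian (h E E')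
  }.

Record real_connection_calculus (h : M -> M -> A) (phi : g -> M)
    (nabla : g -> M -> M) : Prop := RealConnectionCalculus {
  rcc_calculus : real_metric_calculus h phi;
  rcc_connection : affine_connection nabla;
  rcc_hermitian : forall (d : g) E E', range phi E -> range phi E' ->
    hermitian (h (nabla d E) E')
}.

Definition metric_connection (h : M -> M -> A) (nabla : g -> M -> M) : Prop :=
  forall (d : g) U V, val d (h U V) = h (nabla d U) V + h U (nabla d V).

Definition torsion_free (phi : g -> M) (nabla : g -> M -> M) : Prop :=
  forall d1 d2 : g,
    nabla d1 (phi d2) - nabla d2 (phi d1) - phi (lie_bracket d1 d2) = 0.

Record pseudo_riemannian_calculus (h : M -> M -> A) (phi : g -> M)
    (nabla : g -> M -> M) : Prop := PseudoRiemannianCalculus {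
  prc_calculus : real_connection_calculus h phi nabla;
  prc_metric : metric_connection h nabla;
  prc_torsion_free : torsion_free phi nabla
}.

End Calculus.

(* Main.v *)
Require Import Defs.
From mathcomp Require Import all_boot all_order all_algebra.
From mathcomp Require Import boolp classical_sets reals.
From mathcomp Require Import complex.

(** This is the uniqueness half of the Levi-Civita theorem. Since the Leibniz
    terms U d(a) cancel, the difference T of two affine connections is right
    A-linear in its module argument. Consider
      S(d1, d2, d3) = h(T_d1 (phi d2), phi d3).
    Torsion-freeness makes S symmetric in its first two arguments. Metricity
    gives S(d1, d2, d3) + S(d1, d3, d2)^* = 0, and hermiticity of S removes the
    star, so that S is antisymmetric in its last two arguments. Such an S
    vanishes ([sym12_anti23_eq0]). As phi(g) generates M and h is
    non-degenerate, T_d vanishes on phi(g), hence, being A-linear, on all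
    of M ([right_linear_eq0]).

    The hermiticity of h(nabla_d E, E') for E, E' in phi(g) is what takes the
    place of the commutativity of the algebra and the symmetry of the metric
    in the classical argument: without it, moving an argument across h would
    leave a star behind and the symmetries of S would not close up. *)

Set Implicit Arguments.
Unset Strict Implicit.
Unset Printing Implicit Defensive.

Import GRing.Theory Num.Theory.

Local Open Scope ring_scope.

(** The two symmetries are incompatible with the braid relation: the
    transposition (13) is both (12)(23)(12) and (23)(12)(23), which change the
    sign once and twice respectively, so that S = - S. *)
Lemma sym12_anti23_eq0 (K : numFieldType) (V : lmodType K) (X : Type)
    (S : X -> X -> X -> V) :
  (forall x y z, S x y z = S y x z) ->
  (forall x y z, S x y z = - S x z y) ->
  forall x y z, S x y z = 0.
Proof.
move=> sym anti x y z.
have S_opp : S x y z = - S x y z.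
  by rewrite {1}sym anti sym anti opprK sym anti.
have /eqP : 2%:R *: S x y z = 0.
  by rewrite scaler_nat mulr2n {1}S_opp addNr.
by rewrite scaler_eq0 pnatr_eq0 => /eqP.
Qed.

Section RightModule.
Variables (R : realType) (A : starAlgType R) (M : lmodType A^c).

(** Applied both to h(U, _) : M -> A and to the difference of two connections
    M -> M; the common target is an abelian group with an arbitrary function
    [act] playing the part of the right action of A. *)
Lemma right_linear_eq0 (N : zmodType) (act : N -> A -> N) (f : M -> N)
    (B : set M) :
  generates B ->
  (forall a, act 0 a = 0) ->
  (forall U V, f (U + V) = f U + f V) ->
  (forall U a, f (ract U a) = act (f U) a) ->
  (forall E, B E -> f E = 0) ->
  forall U, f U = 0.
Proof.
move=> genB act0 fD fA fB U.
have f0 : f 0 = 0 by apply: (addrI (f 0)); rewrite -fD !addr0.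
have [n [E [a [BE ->]]]] := genB U.
rewrite (big_morph f fD f0) big1 // => i _.
by rewrite fA fB.
Qed.

Lemma form_addl (h : M -> M -> A) : hermitian_form h ->
  forall U V W, h (U + V) W = h U W + h V W.
Proof.
move=> hh U V W.
by rewrite -(form_star hh) (form_add hh) starD !(form_star hh).
Qed.

Lemma form_subl (h : M -> M -> A) : hermitian_form h ->
  forall U V W, h (U - V) W = h U W - h V W.
Proof.
move=> hh U V W; apply: (addIr (h V W)).
by rewrite -(form_addl hh) !subrK.
Qed.

Lemma form_eq0 (h : M -> M -> A) (B : set M) :
  metric h -> generates B ->
  forall U, (forall E, B E -> h U E = 0) -> U = 0.
Proof.
move=> [hh nondeg] genB U hU0; apply: nondeg.
apply: (right_linear_eq0 (act := *%R) genB) => //.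
- exact: mul0r.
- exact: (form_add hh).
- exact: (form_act hh).
Qed.

Variable g : hermLieAlg A.

Section Difference.
Variables nabla1 nabla2 : g -> M -> M.

Definition conn_diff (d : g) (U : M) : M := nabla1 d U - nabla2 d U.

Hypotheses (conn1 : affine_connection nabla1) (conn2 : affine_connection nabla2).

Lemma conn_diff_add d U V : conn_diff d (U + V) = conn_diff d U + conn_diff d V.
Proof.
by rewrite /conn_diff (conn_addr conn1) (conn_addr conn2) opprD addrACA.
Qed.

Lemma conn_diff_act d U a : conn_diff d (ract U a) = ract (conn_diff d U) a.
Proof.
rewrite /conn_diff (conn_leibniz conn1) (conn_leibniz conn2).
by rewrite opprD addrACA subrr addr0 /ract scalerBr.
Qed.

End Difference.

Lemma conn_diff_sym (phi : g -> M) (nabla1 nabla2 : g -> M -> M) :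
  torsion_free phi nabla1 -> torsion_free phi nabla2 ->
  forall d1 d2,
    conn_diff nabla1 nabla2 d1 (phi d2) = conn_diff nabla1 nabla2 d2 (phi d1).
Proof.
move=> tf1 tf2 d1 d2; rewrite /conn_diff.
have swap nabla : torsion_free phi nabla ->
    nabla d1 (phi d2) = phi (lie_bracket d1 d2) + nabla d2 (phi d1).
  by move=> tf; apply/eqP; rewrite -subr_eq -subr_eq0 tf.
by rewrite (swap _ tf1) (swap _ tf2) opprD addrACA subrr add0r.
Qed.

Lemma conn_diff_skew (h : M -> M -> A) (nabla1 nabla2 : g -> M -> M) :
  hermitian_form h ->
  metric_connection h nabla1 -> metric_connection h nabla2 ->
  forall d U V, h (conn_diff nabla1 nabla2 d U) V =
    - star (h (conn_diff nabla1 nabla2 d V) U).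
Proof.
move=> hh met1 met2 d U V; rewrite (form_star hh).
have hBr : h U (conn_diff nabla1 nabla2 d V) = h U (nabla1 d V) - h U (nabla2 d V).
  by apply: (addIr (h U (nabla2 d V))); rewrite -(form_add hh) !subrK.
rewrite hBr (form_subl hh) opprB.
apply/eqP; rewrite subr_eq addrAC eq_sym subr_eq.
by rewrite addrC -met2 met1.
Qed.

Lemma conn_diff_hermitian (h : M -> M -> A) (phi : g -> M)
    (nabla1 nabla2 : g -> M -> M) :
  real_connection_calculus h phi nabla1 ->
  real_connection_calculus h phi nabla2 ->
  forall d d2 d3,
    Defs.hermitian (h (conn_diff nabla1 nabla2 d (phi d2)) (phi d3)).
Proof.
move=> rcc1 rcc2 d d2 d3.
have [hh _] := rmc_metric (rcc_calculus rcc1).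
have phi_range d' : range phi (phi d') by exists d'.
have H1 := rcc_hermitian rcc1 d (phi_range d2) (phi_range d3).
have H2 := rcc_hermitian rcc2 d (phi_range d2) (phi_range d3).
rewrite /Defs.hermitian /conn_diff (form_subl hh).
apply: (addIr (h (nabla2 d (phi d2)) (phi d3))).
by rewrite -{2}H2 -starD !subrK.
Qed.

End RightModule.

Theorem theorem3p4 (R : realType) (A : starAlgType R) (M : lmodType A^c)
    (h : M -> M -> A) (g : hermLieAlg A) (phi : g -> M) :
  real_metric_calculus h phi ->
  forall nabla1 nabla2 : g -> M -> M,
    affine_connection nabla1 -> pseudo_riemannian_calculus h phi nabla1 ->
    affine_connection nabla2 -> pseudo_riemannian_calculus h phi nabla2 ->
    nabla1 = nabla2.
Proof.
move=> rmc nabla1 nabla2 conn1 [rcc1 met1 tf1] conn2 [rcc2 met2 tf2].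
have gen := rmc_generates rmc.
have [hh _] := rmc_metric rmc.
pose T := conn_diff nabla1 nabla2.
have S0 d1 d2 d3 : h (T d1 (phi d2)) (phi d3) = 0.
  apply: (sym12_anti23_eq0 (S := fun x y z => h (T x (phi y)) (phi z))) => x y z.
  - by rewrite /T (conn_diff_sym tf1 tf2).
  - by rewrite /T (conn_diff_skew hh met1 met2) (conn_diff_hermitian rcc1 rcc2).
have Tphi d d2 : T d (phi d2) = 0.
  by apply: (form_eq0 (rmc_metric rmc) gen) => _ [d3 _ <-].
apply/funext => d; apply/funext => U; apply: subr0_eq.
apply: (right_linear_eq0 (act := @ract _ _ M) (f := T d) gen).
- by move=> a; rewrite /ract scaler0.
- exact: (conn_diff_add conn1 conn2).
- exact: (conn_diff_act conn1 conn2).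
- by move=> _ [d2 _ <-]; apply: Tphi.
Qed.
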